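(* For each $\epsilon>0$ there exist continuous functions $b,k:[0,\infty)\to\mathbb{R}$ with $b(t)>0$ and $k(t)<0$ for all $t\ge0$ such that the zero solution of $$u''(t)+b(t)u'(t)+k(t)u(t)=0,\qquad t\ge 0,$$ is stable (with initial time $t_0=0$), and such that the eigenvalues $$\lambda_\pm(t)=\frac{-b(t)\pm\sqrt{b(t)^2-4k(t)}}{2}$$ of the matrix $A(t)=\begin{pmatrix}0&1\\-k(t)&-b(t)\end{pmatrix}$ are differentiable functions of $t$ satisfying $\left|\frac{d\lambda_\pm}{dt}(t)\right|<\epsilon$ for all $t\ge 0$.
   Context: With initial time $t_0=0$, the zero solution of the second-order equation is called stable if for each $\eta>0$ there exists $\delta>0$ such that every solution $u$ on $[0,\infty)$ with $u(0)^2+u'(0)^2<\delta^2$ satisfies $u(t)^2+u'(t)^2<\eta^2$ for all $t\ge 0$. *)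

(* Defs.v *)
From HB Require Import structures.
From mathcomp Require Import all_boot all_order all_algebra.
From mathcomp Require Import all_classical all_reals all_analysis.
Set Implicit Arguments.
Unset Strict Implicit.
Unset Printing Implicit Defensive.
Import Order.TTheory GRing.Theory Num.Theory.
Import numFieldNormedType.Exports.
Local Open Scope classical_set_scope.
Local Open Scope ring_scope.

Section Defs.
Variable R : realType.
Implicit Types (f b k u du : R -> R) (t l : R).

(* A function on [0, +oo[ is represented by a total function R -> R, of which
   only the restriction to this set is ever constrained. *)
Definition halfline : set R := [set t | 0 <= t].

(* f, as a function on [0, +oo[, has derivative l at t. The library's
   derivative is two-sided; at t = 0 the restriction of the limit to halfline
   makes this the right derivative, and at t > 0 it changes nothing. *)
Definition has_deriv f t l : Prop :=
  (fun s => (f s - f t) / (s - t)) @ within halfline (dnbhs t) --> l.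

(* du is a second argument because the derivative of u relative to halfline is
   not a term built from u; has_deriv determines it uniquely on halfline. *)
Definition solution b k u du : Prop :=
  exists ddu : R -> R, forall t, 0 <= t ->
    [/\ has_deriv u t (du t), has_deriv du t (ddu t)
      & ddu t + b t * du t + k t * u t = 0].

Definition zero_stable b k : Prop :=
  forall eta : R, 0 < eta ->
    exists2 delta : R, 0 < delta &
      forall u du, solution b k u du ->
        u 0 ^+ 2 + du 0 ^+ 2 < delta ^+ 2 ->
        forall t, 0 <= t -> u t ^+ 2 + du t ^+ 2 < eta ^+ 2.

Definition coef_mx b k t : 'M[R]_2 :=
  \matrix_(i < 2, j < 2)
    nth 0 (nth [::] [:: [:: 0; 1]; [:: - k t; - b t]] i) j.

Definition lambda_plus b k t : R :=
  (- b t + Num.sqrt (b t ^+ 2 - 4 * k t)) / 2.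

Definition lambda_minus b k t : R :=
  (- b t - Num.sqrt (b t ^+ 2 - 4 * k t)) / 2.

End Defs.

Arguments halfline : clear implicits.

(* Main.v *)
Require Import Defs.
From HB Require Import structures.
From mathcomp Require Import all_boot all_order all_algebra.
From mathcomp Require Import all_classical all_reals all_analysis.
From mathcomp Require Import ring lra.
Set Implicit Arguments.
Unset Strict Implicit.
Unset Printing Implicit Defensive.
Import Order.TTheory GRing.Theory Num.Theory.
Import numFieldNormedType.Exports.
Local Open Scope classical_set_scope.
Local Open Scope ring_scope.

(** Take b = 1 and make k a small, integrable, negative perturbation of 0.
    For k = - q with q >= 0, put p = u + u', so that p' = q u and
    u'' = - u' + q u. The energy E = p ^ 2 + u' ^ 2 then satisfies
    E' = 2 q p ^ 2 - 2 (1 + q) u' ^ 2 <= 2 q E,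
    hence E is bounded by a constant multiple of E 0 as soon as q is integrable.
    Concretely, a bounded decreasing weight absorbs the growth: if
    4 q <= (1 + t) ^- 2, then E * (1 + (1 + t)^-1) is nonincreasing
    ([energy_nincr]). Since E and u ^ 2 + u' ^ 2 are equivalent
    quadratic forms, stability follows ([zero_stable_small_negative]).

    To avoid square roots in the eigenvalues, prescribe the positive eigenvalue
    r instead of k: the other one must be - (1 + r), because their sum is - 1,
    and k = - (r + r ^ 2) is their product. With r = c (1 + t) ^- 2 both
    eigenvalues have derivatives bounded by 2 c, and a small c makes this bound
    less than eps while q = r + r ^ 2 satisfies the smallness condition above.
    So the negative eigenvalue stays near - 1, while the positive one tends to 0
    fast enough to be harmless, although it moves slowly. *)

(** Away from 0 the half-line is a neighbourhood of t, so the quotients relative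
    to it are those of the two-sided derivative. *)
Lemma has_deriv_is_derive (R : realType) (f : R -> R) (t l : R) :
  0 < t -> has_deriv f t l -> is_derive t 1 f l.
Proof.
move=> t_gt0 df.
suff cf : h^-1 *: (f (h *: 1 + t) - f t) @[h --> 0^'] --> l.
  by split; [apply/cvg_ex; exists l | exact: cvg_lim].
apply/cvgrPdist_lt => e e_gt0.
move/cvgrPdist_lt: df => /(_ _ e_gt0) /nbhs_ballP[d /= d_gt0 ballP].
apply/nbhs_ballP; exists (Num.min d t) => /=; first by rewrite lt_min d_gt0.
move=> h; rewrite /ball /= sub0r normrN lt_min => /andP[h_lt_d h_lt_t] h_neq0.
have := ballP (h + t); rewrite /ball /= opprD addrCA subrr addr0 normrN.
rewrite -[h *: 1]/(h * 1) mulr1 addrK [_ *: _]mulrC; apply => //.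
  by rewrite -subr_eq0 addrK.
by rewrite /halfline /=; move: h_lt_t; rewrite ltr_norml; lra.
Qed.

Lemma is_derive_has_deriv (R : realType) (f : R -> R) (t l : R) :
  is_derive t 1 f l -> has_deriv f t l.
Proof.
case=> /cvg_ex[l' cf] fl.
have {cf l' fl}: h^-1 *: (f (h *: 1 + t) - f t) @[h --> 0^'] --> l.
  by rewrite -fl /derive (cvg_lim _ cf).
move=> /cvgrPdist_lt df; apply/cvgrPdist_lt => e e_gt0.
move: df => /(_ _ e_gt0) /nbhs_ballP[d /= d_gt0 ballP].
apply/nbhs_ballP; exists d => //= s; rewrite /ball /= => s_near s_neq _.
have := ballP (s - t).
rewrite /ball /= sub0r normrN distrC subr_eq0 => /(_ s_near s_neq).
by rewrite -[_ *: 1]/(_ * 1) mulr1 subrK [_ *: _]mulrC.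
Qed.

(** The one-sided version of differentiable-implies-continuous: it supplies
    continuity at the left end point 0, where the two-sided theory is silent. *)
Lemma has_deriv_continuous (R : realType) (f : R -> R) (t l : R) :
  has_deriv f t l -> f s @[s --> within (halfline R) (nbhs t)] --> f t.
Proof.
move=> df; apply/cvgrPdist_lt => e e_gt0.
move/cvgrPdist_lt: df => /(_ _ ltr01) /nbhs_ballP[d /= d_gt0 ballP].
have M_gt0 : 0 < `|l| + 1 by rewrite ltr_wpDl.
apply/nbhs_ballP; exists (Num.min d (e / (`|l| + 1))) => /=.
  by rewrite lt_min d_gt0 divr_gt0.
move=> s; rewrite /ball /= lt_min => /andP[s_lt_d s_lt_e] s_ge0.
have [->|s_neq] := eqVneq s t; first by rewrite subrr normr0.
have := ballP s s_lt_d s_neq s_ge0.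
set q := (f s - f t) / (s - t) => q_near_l.
have st0 : s - t != 0 by rewrite subr_eq0.
have -> : f t - f s = q * (t - s) by rewrite /q; field.
rewrite normrM; apply: le_lt_trans (_ : (`|l| + 1) * `|t - s| < e); last first.
  by rewrite mulrC -ltr_pdivlMr.
rewrite ler_wpM2r //; have := ler_normB l (l - q).
by rewrite subKr; lra.
Qed.

Lemma eq_has_deriv (R : realType) (f g : R -> R) (t l : R) :
  (forall s, 0 <= s -> f s = g s) -> 0 <= t ->
  has_deriv f t l -> has_deriv g t l.
Proof.
move=> fg t_ge0; rewrite /has_deriv; apply: cvg_trans.
apply: near_eq_cvg; rewrite near_withinE; near=> s => s_ge0.
by rewrite !fg.
Unshelve. all: by end_near.
Qed.

(** The characteristic polynomial is a ^ 2 + b a + k. Its discriminant has to be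
    nonnegative because [Num.sqrt] is 0 on negative numbers. *)
Lemma eigenvalue_coef_mx (R : realType) (b k : R -> R) (t a : R) :
  0 <= b t ^+ 2 - 4 * k t ->
  eigenvalue (coef_mx b k t) a <->
  a = lambda_plus b k t \/ a = lambda_minus b k t.
Proof.
move=> disc_ge0; rewrite eigenvalue_root_char rootE /char_poly.
rewrite (expand_det_row _ 0) !big_ord_recl big_ord0 /cofactor !det_mx11.
rewrite !mxE /= !hornerE /=.
rewrite /lambda_plus /lambda_minus.
have := sqr_sqrtr disc_ge0; set r := Num.sqrt _ => r2.
set p := (X in X == 0).
have -> : p = (a - (- b t + r) / 2) * (a - (- b t - r) / 2).
  rewrite /p.
  have -> : k t = (b t ^+ 2 - r ^+ 2) / 4 by rewrite r2; field.
  by field.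
rewrite mulf_eq0 !subr_eq0.
by split=> [/orP[]/eqP|[]->]; rewrite ?eqxx ?orbT; auto.
Qed.

(** With b = 1 and k = - (r + r ^ 2) the discriminant is the perfect square
    (1 + 2 r) ^ 2. *)
Lemma lambda_plusE (R : realType) (r : R -> R) (t : R) : 0 <= r t ->
  lambda_plus (cst 1) (fun s => - (r s + r s ^+ 2)) t = r t.
Proof.
move=> r_ge0; rewrite /lambda_plus /cst.
have -> : 1 ^+ 2 - 4 * - (r t + r t ^+ 2) = (1 + 2 * r t) ^+ 2 by ring.
by rewrite sqrtr_sqr ger0_norm; [field | lra].
Qed.

Lemma lambda_minusE (R : realType) (r : R -> R) (t : R) : 0 <= r t ->
  lambda_minus (cst 1) (fun s => - (r s + r s ^+ 2)) t = - (1 + r t).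
Proof.
move=> r_ge0; rewrite /lambda_minus /cst.
have -> : 1 ^+ 2 - 4 * - (r t + r t ^+ 2) = (1 + 2 * r t) ^+ 2 by ring.
by rewrite sqrtr_sqr ger0_norm; [field | lra].
Qed.

Section Stability.
Context {R : realType}.
Variable q : R -> R.
Hypothesis q_ge0 : forall t : R, 0 <= t -> 0 <= q t.
Hypothesis q_small : forall t : R, 0 <= t -> 4 * q t <= (1 + t) ^- 2.

(** The form (u + v) ^ 2 + v ^ 2 times the weight that absorbs its growth. *)
Let energy (u v : R -> R) : R -> R :=
  ((u + v) * (u + v) + v * v) * (cst 1 + (fun s => (1 + s)^-1)).

(** With i = (1 + x)^-1, the growth rate 2 q of the quadratic form is compensated
    by the weight 1 + i <= 2, whose derivative is - i ^ 2 <= - 4 q. *)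
Let energy_nincr (u v : R -> R) (t : R) :
  solution (cst 1) (fun s => - q s) u v ->
  0 <= t -> energy u v t <= energy u v 0.
Proof.
move=> [w sol] t_ge0.
have drv (x : R) : 0 < x -> exists2 l, is_derive x 1 (energy u v) l & l <= 0.
  move=> x_gt0; have [du dv eq] := sol _ (ltW x_gt0).
  have := has_deriv_is_derive x_gt0 du; have := has_deriv_is_derive x_gt0 dv.
  move=> dv' du'.
  have x1 : 1 + x != 0 by lra.
  have di : is_derive x 1 (fun s : R => (1 + s)^-1) (- (1 + x) ^- 2 *: (0 + 1)).
    by apply: is_deriveV.
  set i := (1 + x)^-1.
  exists (2 * ((u x + v x) * (v x + w x) + v x * w x) * (1 + i)
          - ((u x + v x) ^+ 2 + v x ^+ 2) * i ^+ 2).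
    apply: is_derive_eq; rewrite /cst !fctE /GRing.scale /= -exprVn -/i; ring.
  have -> : w x = q x * u x - v x by move: eq; rewrite /cst; lra.
  (* In the coordinates p, v the cross terms of the derivative cancel. *)
  set p := u x + v x; have -> : u x = p - v x by rewrite /p addrK.
  have i_gt0 : 0 < i by rewrite invr_gt0; lra.
  have i_le1 : i <= 1 by rewrite invf_le1; lra.
  have q0 := q_ge0 (ltW x_gt0); have := q_small (ltW x_gt0).
  rewrite -exprVn -/i => qi.
  have -> : 2 * (p * (v x + (q x * (p - v x) - v x))
                 + v x * (q x * (p - v x) - v x)) * (1 + i)
            - (p ^+ 2 + v x ^+ 2) * i ^+ 2
          = - (2 * (1 + q x) * (1 + i) * v x ^+ 2 + i ^+ 2 * v x ^+ 2
               + (i ^+ 2 - 4 * q x) * p ^+ 2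
               + 2 * q x * (1 - i) * p ^+ 2) by ring.
  have p2 := sqr_ge0 p; have v2 := sqr_ge0 (v x); have i2 := sqr_ge0 i.
  by rewrite oppr_le0; do !apply: addr_ge0; apply: mulr_ge0 => //; nra.
apply: (ler0_derive1_nincry (a := 0) _ _ _ (lexx 0) t_ge0).
- by move=> x; rewrite in_itv /= andbT => /drv[l []].
- by move=> x; rewrite in_itv /= andbT => /drv[l [_ <-]]; rewrite derive1E.
- apply/subspace_continuousP => x /=; rewrite in_itv /= andbT => x_ge0.
  have -> : [set` `[0, +oo[] = halfline R by rewrite set_itvE.
  have [/has_deriv_continuous cu /has_deriv_continuous cv _] := sol _ x_ge0.
  have ci : (1 + s)^-1 @[s --> within (halfline R) (nbhs x)] --> (1 + x)^-1.
    apply: cvgV; first by lra.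
    by apply: cvgD; [exact: cvg_cst | exact: cvg_within].
  apply: cvgM; last by apply: cvgD => //; exact: cvg_cst.
  apply: cvgD; apply: cvgM => //; exact: cvgD.
Qed.

(** The weight lies between 1 and 2, and the energy form lies between
    1/3 and 3 times u ^ 2 + v ^ 2, so the squared norm grows by a factor of at
    most 18, which is less than 5 ^ 2. *)
Lemma zero_stable_small_negative : zero_stable (cst 1) (fun s => - q s).
Proof.
move=> eta eta_gt0; exists (eta / 5); first lra.
move=> u v sol init t t_ge0.
have := energy_nincr sol t_ge0; rewrite /energy /cst !fctE addr0 invr1.
set i := (1 + t)^-1 => le_energy.
have i_gt0 : 0 < i by rewrite invr_gt0; lra.
have eta2 : 0 < eta ^+ 2 by rewrite exprn_gt0.
have {}init : 25 * (u 0 ^+ 2 + v 0 ^+ 2) < eta ^+ 2.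
  by move: init; rewrite expr_div_n; lra.
have at_t : u t ^+ 2 + v t ^+ 2 <=
    3 * (((u t + v t) * (u t + v t) + v t * v t) * (1 + i)).
  (* 2 (3 (u + v) ^ 2 + 3 v ^ 2 - u ^ 2 - v ^ 2)
     = (2 u + 3 v) ^ 2 + v ^ 2. *)
  have := sqr_ge0 (2 * u t + 3 * v t); have := sqr_ge0 (v t).
  have : 0 <= ((u t + v t) ^+ 2 + v t ^+ 2) * i.
    by rewrite mulr_ge0 ?addr_ge0 ?sqr_ge0// ltW.
  lra.
have := sqr_ge0 (u 0 - v 0); have := sqr_ge0 (u 0).
lra.
Qed.

End Stability.

Lemma is_derive_inv_sqr (R : realType) (c t : R) : 0 <= t ->
  is_derive t 1 (fun s : R => c * (1 + s) ^- 2) (- 2 * c * (1 + t) ^- 3).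
Proof.
move=> t_ge0.
have t1 : 1 + t != 0 by lra.
have -> : (fun s : R => c * (1 + s) ^- 2) =
    c *: ((fun s => (1 + s)^-1) ^+ 2).
  by apply/funext => s; rewrite -exprVn.
have di : is_derive t 1 (fun s : R => (1 + s)^-1) (- (1 + t) ^- 2 *: (0 + 1)).
  by apply: is_deriveV.
by apply: is_derive_eq; rewrite /GRing.scale /=; field.
Qed.

Theorem mainTheorem6 (R : realType) (eps : R) (eps_gt0 : 0 < eps) :
  exists b k : R -> R,
    [/\ {within halfline R, continuous b} /\ {within halfline R, continuous k},
        forall t : R, 0 <= t -> 0 < b t /\ k t < 0,
        zero_stable b k,
        forall t : R, 0 <= t -> forall a : R,
          eigenvalue (coef_mx b k t) a <->
          a = lambda_plus b k t \/ a = lambda_minus b k t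
      & forall t : R, 0 <= t ->
          (exists2 l : R, has_deriv (lambda_plus b k) t l & `|l| < eps) /\
          (exists2 l : R, has_deriv (lambda_minus b k) t l & `|l| < eps)].
Proof.
(* 1 / 8 gives 4 (r + r ^ 2) <= 8 r <= (1 + t) ^- 2, and eps / 4 gives
   2 c < eps. *)
pose c := Num.min (1 / 8) (eps / 4).
have c_gt0 : 0 < c by rewrite lt_min; apply/andP; split; lra.
have c_le8 : c <= 1 / 8 by rewrite ge_min lexx.
have c_le_eps : c <= eps / 4 by rewrite ge_min lexx orbT.
pose r (t : R) := c * (1 + t) ^- 2.
have i_bound (t : R) : 0 <= t -> 0 < (1 + t)^-1 <= 1.
  by move=> t_ge0; rewrite invr_gt0 invf_le1; lra.
have r_gt0 (t : R) : 0 <= t -> 0 < r t.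
  by move=> /i_bound/andP[i_gt0 _]; rewrite mulr_gt0 // -exprVn exprn_gt0.
have r_le1 (t : R) : 0 <= t -> r t <= 1.
  move=> /i_bound/andP[i_gt0 i_le1]; rewrite /r -exprVn.
  have : (1 + t)^-1 ^+ 2 <= 1 by rewrite exprn_ile1 // ltW.
  have := exprn_gt0 2 i_gt0; nra.
have dr (t : R) : 0 <= t ->
    exists2 l, is_derive t 1 r l & `|l| < eps.
  move=> t_ge0; exists (- 2 * c * (1 + t) ^- 3); first exact: is_derive_inv_sqr.
  have /andP[i_gt0 i_le1] := i_bound _ t_ge0.
  rewrite -exprVn mulrAC; set j := _ ^+ 3.
  have j_gt0 : 0 < j by rewrite exprn_gt0.
  have j_le1 : j <= 1 by rewrite exprn_ile1 // ltW.
  by rewrite ltr_norml; apply/andP; split; nra.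
exists (cst 1), (fun t => - (r t + r t ^+ 2)); split.
- split; first by apply: continuous_in_subspaceT => t _; exact: cvg_cst.
  apply/subspace_continuousP => t /dr[l /is_derive_has_deriv].
  move=> /has_deriv_continuous cr _.
  by apply: cvgN; apply: cvgD => //; apply: cvgM.
- by move=> t /r_gt0 rt; split; rewrite /cst //; nra.
- apply: zero_stable_small_negative => t t_ge0.
    by have := r_gt0 _ t_ge0; nra.
  have := r_gt0 _ t_ge0; have := r_le1 _ t_ge0.
  have : 8 * r t <= (1 + t) ^- 2.
    have /andP[i_gt0 _] := i_bound _ t_ge0.
    by have := exprn_gt0 2 i_gt0; rewrite /r -exprVn; nra.
  nra.
- move=> t /r_gt0 rt a; apply: eigenvalue_coef_mx; rewrite /cst; nra.
- move=> t t_ge0; have [l rl l_lt] := dr _ t_ge0; split.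
    exists l => //; apply: eq_has_deriv t_ge0 (is_derive_has_deriv rl) => s s_ge0.
    by rewrite lambda_plusE // ltW // r_gt0.
  exists (- l); last by rewrite normrN.
  apply: (@eq_has_deriv _ (- (cst 1 + r)) _ _ _ _ t_ge0) => [s s_ge0|].
    by rewrite lambda_minusE // ltW // r_gt0.
  by apply: is_derive_has_deriv; apply: is_derive_eq; rewrite add0r.
Qed.
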